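(* Let $\mathbb{T}$ be a time scale that is unbounded above and has bounded graininess. A $p\times q$ transfer function $G(z)$ admits a time invariant realization by a regressive linear system $$x^{\Delta}(t)=Ax(t)+Bu(t),\qquad y(t)=Cx(t),$$ if and only if each entry of $G(z)$ is a strictly-proper rational function of $z$.
   Context: A time scale $\mathbb{T}$ is a nonempty closed subset of $\mathbb{R}$, with forward jump operator $\sigma(t)=\inf\{s\in\mathbb{T}:s>t\}$ and graininess $\mu(t)=\sigma(t)-t$; $x^\Delta$ denotes the delta derivative. The system is regressive if $I+\mu(t)A$ is invertible for all $t\in\mathbb{T}$; it is an assumption made throughout that all systems in question are regressive. A $p\times q$ transfer function $G(z)$ is a $p\times q$ matrix of functions of the complex variable $z$. The system with constant real matrices $A$ ($n\times n$), $B$ ($n\times q$), $C$ ($p\times n$) is a time invariant realization of $G(z)$, of dimension $n$, if $C(zI-A)^{-1}B=G(z)$. A strictly-proper rational function of $z$ is a rational function of $z$ such that the degree of the numerator is strictly less than the degree of the denominator (the zero function included); rational functions have real coefficients, in accordance with the system matrices being real.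
   Formalization: G is additionally assumed continuous at every point -1/μ(t) with t in T and μ(t) ≠ 0; without this the claim fails, e.g. G(z) = 1/(z+1) on the integers is strictly proper but has no regressive realization. *)

(* Defs.v *)
From mathcomp Require Export all_boot all_order all_algebra.
From mathcomp Require Export complex.
From mathcomp Require Export boolp classical_sets reals topology normedtype.
Export numFieldNormedType.Exports.
Export Order.TTheory GRing.Theory Num.Theory.

Set Implicit Arguments.
Unset Strict Implicit.
Unset Printing Implicit Defensive.

Local Open Scope classical_set_scope.
Local Open Scope ring_scope.
Local Open Scope complex_scope.

Definition time_scale (R : realType) (T : set R) : Prop :=
  T !=set0 /\ closed T.

(* [inf set0 = 0], so this agrees with the usual forward jump at [t] only when
   [T] has a point to the right of [t], as is the case for all [t] when [T] is
   unbounded above. *)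
Definition sigma (R : realType) (T : set R) (t : R) : R :=
  inf [set s | T s /\ t < s].

Definition mu (R : realType) (T : set R) (t : R) : R := sigma T t - t.

(* The system x^Delta = A x + B u, y = C x with n states, q inputs and
   p outputs. *)
Record linear_system (R : realType) (n p q : nat) := LinearSystem {
  sysA : 'M[R]_n ;
  sysB : 'M[R]_(n, q) ;
  sysC : 'M[R]_(p, n)
}.

Definition regressive (R : realType) (T : set R) (n p q : nat)
    (S : linear_system R n p q) : Prop :=
  forall t, T t -> 1%:M + mu T t *: sysA S \in unitmx.

Definition cmx (R : realType) (m n : nat) (M : 'M[R]_(m, n)) : 'M[R[i]]_(m, n) :=
  map_mx (real_complex R) M.

Definition cpoly (R : realType) (f : {poly R}) : {poly R[i]} :=
  map_poly (real_complex R) f.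

(* A transfer function is a total Rocq function; its values at the points where
   the formula for it has no meaning (eigenvalues of A, zeros of a denominator)
   are left unconstrained. *)
Definition realizes (R : realType) (n p q : nat) (S : linear_system R n p q)
    (G : R[i] -> 'M[R[i]]_(p, q)) : Prop :=
  forall z : R[i], z%:M - cmx (sysA S) \in unitmx ->
    cmx (sysC S) *m invmx (z%:M - cmx (sysA S)) *m cmx (sysB S) = G z.

(* [size] is the degree plus one, and [size 0 = 0]: the inequality forces
   [den != 0] and admits [num = 0]. *)
Definition strictly_proper_rational (R : realType) (g : R[i] -> R[i]) : Prop :=
  exists num den : {poly R}, (size num < size den)%N /\
    forall z : R[i], (cpoly den).[z] != 0 ->
      g z = (cpoly num).[z] / (cpoly den).[z].

(* The standing regressivity assumption, for a transfer function. Since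
   I + mu(t) A is singular exactly when mu(t) != 0 and -1/mu(t) is an eigenvalue
   of A, the function C (zI - A)^-1 B of a regressive system has no singularity
   at the points -1/mu(t). Without this, 1/(z + 1) on the time scale of the
   integers is strictly proper but has no regressive realization.
   [R[i]] is viewed as a [numFieldType] to get its topology from the modulus. *)
Definition regressive_transfer (R : realType) (T : set R) (p q : nat)
    (G : R[i] -> 'M[R[i]]_(p, q)) : Prop :=
  forall (t : R) (i : 'I_p) (j : 'I_q), T t -> mu T t != 0 ->
    {for (- (mu T t)^-1)%:C,
      continuous ((fun z => G z i j) : (R[i] : numFieldType) -> (R[i] : numFieldType))}.

(* Main.v *)
(* By Cramer's rule, the entries of C (zI - A)^-1 B are those of C adj(zI - A) B
   divided by the characteristic polynomial of A. Conversely, write an entry as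
   num / den. If den vanishes at l = -1/mu(t), so does num, since the entry is
   continuous at l; cancelling X - l repeatedly, one gets a den with no root of
   the form -1/mu(t). The companion matrix of den then yields a regressive
   realization of that entry, and a direct sum of these realizes the matrix. *)
Require Import Defs.

Set Implicit Arguments.
Unset Strict Implicit.
Unset Printing Implicit Defensive.

Local Open Scope classical_set_scope.
Local Open Scope ring_scope.

(** * Resolvents and characteristic polynomials *)

Lemma horner_char_poly_mx (F : comNzRingType) (n : nat) (A : 'M[F]_n) (z : F) :
  map_mx (horner_eval z) (char_poly_mx A) = z%:M - A.
Proof.
apply/matrixP => i j; rewrite !mxE horner_evalE.
by rewrite hornerD hornerN hornerMn hornerX hornerC.
Qed.

Lemma horner_char_poly (F : comNzRingType) (n : nat) (A : 'M[F]_n) (z : F) :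
  (char_poly A).[z] = \det (z%:M - A).
Proof. by rewrite -horner_evalE -det_map_mx horner_char_poly_mx. Qed.

Lemma unitmx_char_poly (F : fieldType) (n : nat) (A : 'M[F]_n) (z : F) :
  (z%:M - A \in unitmx) = ((char_poly A).[z] != 0).
Proof. by rewrite unitmxE unitfE horner_char_poly. Qed.

(** A cofactor is, up to sign, a minor of order [n - 1] whose entries have degree at most 1. *)
Lemma size_adj_char_poly_mx (F : idomainType) (n : nat) (A : 'M[F]_n)
    (i j : 'I_n) : (size (\adj (char_poly_mx A) i j) <= n)%N.
Proof.
rewrite mxE /cofactor size_Msign /determinant.
apply: (leq_trans (size_sum _ _ _)); apply/bigmax_leqP => s _.
rewrite size_Msign.
have size_entry k l : (size ((char_poly_mx A) k l) <= 2)%N.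
  rewrite !mxE (leq_trans (size_polyD _ _))// geq_max size_polyN size_polyC.
  rewrite (leq_trans (leq_b1 _))// andbT.
  by case: (k == l); rewrite ?size_polyX ?size_poly0.
case: n A i j s size_entry => [|n] A i j s size_entry; first by case: i.
(* A product of [n] factors of size at most 2 has size at most [2 * n + 1 - n], which is [n.+1]. *)
apply: (leq_trans (size_prod_leq _ _)).
rewrite card_ord leq_subLR addnC.
have -> : (n.+1 + n = (\sum_(i < n) 2).+1)%N.
  by rewrite sum_nat_const card_ord muln2 -addnn addSn.
rewrite ltnS leq_sum// => k _.
by rewrite 2!mxE size_entry.
Qed.

Lemma strictly_proper_realizes (R : realType) (n p q : nat)
    (S : linear_system R n p q) (G : R[i]%C -> 'M[R[i]%C]_(p, q))
    (i : 'I_p) (j : 'I_q) :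
  realizes S G -> strictly_proper_rational (fun z => G z i j).
Proof.
(* The numerators are formed over [R], since [num] and [den] must have real coefficients. *)
move=> SG; pose P := map_mx polyC (sysC S) *m \adj (char_poly_mx (sysA S)) *m
  map_mx polyC (sysB S).
exists (P i j), (char_poly (sysA S)); split.
  rewrite size_char_poly ltnS mxE (leq_trans (size_sum _ _ _))//.
  apply/bigmax_leqP => k _; rewrite mxE [X in _ * X]mxE mulrC mul_polyC.
  rewrite (leq_trans (size_scale_leq _ _))// (leq_trans (size_sum _ _ _))//.
  apply/bigmax_leqP => l _; rewrite [X in X * _]mxE mul_polyC.
  by rewrite (leq_trans (size_scale_leq _ _))// size_adj_char_poly_mx.
move=> z; rewrite /cpoly map_char_poly => z0.
have u : z%:M - cmx (sysA S) \in unitmx by rewrite unitmx_char_poly.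
rewrite -SG// /invmx u.
(* Evaluating a real polynomial at a complex point is a ring morphism, so it commutes with products
   and adjugates of matrices. *)
have -> : (map_poly (real_complex R) (P i j)).[z] =
    map_mx (horner_eval z \o map_poly (real_complex R)) P i j.
  by rewrite [RHS]mxE.
rewrite map_mx_comp /P !map_mxM !map_mx_adj map_char_poly_mx.
have hC a b (M : 'M[R]_(a, b)) :
    map_mx (horner_eval z) (map_mx (map_poly (real_complex R))
      (map_mx polyC M)) = cmx M.
  by apply/matrixP => k l; rewrite !mxE map_polyC horner_evalE hornerC.
rewrite !hC horner_char_poly_mx horner_char_poly -/(cmx _).
by rewrite -scalemxAr -scalemxAl mxE mulrC.
Qed.

(** * Direct sums of regressive realizations *)

Definition regressively_realizable (R : realType) (T : set R) (p q : nat)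
    (G : R[i]%C -> 'M[R[i]%C]_(p, q)) : Prop :=
  exists n (S : linear_system R n p q), regressive T S /\ realizes S G.

Lemma regressively_realizable0 (R : realType) (T : set R) (p q : nat) :
  regressively_realizable T (fun=> 0 : 'M[R[i]%C]_(p, q)).
Proof.
exists 0, (LinearSystem 0 0 0); split=> [t _|z _] /=.
  by rewrite scaler0 addr0 unitmx1.
by rewrite /cmx !map_mx0 mulmx0.
Qed.

(** Both systems receive the same input and their outputs are added. A block diagonal matrix is
    invertible exactly when both blocks are, which settles regressivity and the resolvent alike. *)
Lemma regressively_realizableD (R : realType) (T : set R) (p q : nat)
    (G H : R[i]%C -> 'M[R[i]%C]_(p, q)) :
  regressively_realizable T G -> regressively_realizable T H ->
  regressively_realizable T (fun z => G z + H z).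
Proof.
move=> [m [S1 [r1 R1]]] [n [S2 [r2 R2]]].
exists (m + n)%N, (LinearSystem (block_mx (sysA S1) 0 0 (sysA S2))
  (col_mx (sysB S1) (sysB S2)) (row_mx (sysC S1) (sysC S2))).
split=> [t Tt|z] /=.
  rewrite scale_block_mx !scaler0 (scalar_mx_block m n) add_block_mx !addr0.
  by rewrite block_diag_mx_unit r1// r2.
rewrite /cmx map_block_mx !map_mx0 map_col_mx map_row_mx (scalar_mx_block m n).
rewrite opp_block_mx add_block_mx !oppr0 !addr0 => u.
rewrite invmx_block_diag// mul_row_block !mulmx0 addr0 add0r mul_row_col.
by move: u; rewrite block_diag_mx_unit => /andP[u1 u2]; rewrite -R1// -R2.
Qed.

Lemma regressively_realizable_sum (R : realType) (T : set R) (p q : nat)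
    (I : Type) (r : seq I) (G : I -> R[i]%C -> 'M[R[i]%C]_(p, q)) :
  (forall i, regressively_realizable T (G i)) ->
  regressively_realizable T (fun z => \sum_(i <- r) G i z).
Proof.
move=> rG; elim: r => [|i r ih].
  under eq_fun do rewrite big_nil; exact: regressively_realizable0.
under eq_fun do rewrite big_cons.
exact: regressively_realizableD.
Qed.

(** * Companion realization of a single entry *)

Lemma unitmx_regressive (R : realType) (T : set R) (n : nat) (A : 'M[R]_n)
    (t : R) :
  (mu T t != 0 -> (char_poly A).[- (mu T t)^-1] != 0) ->
  1%:M + mu T t *: A \in unitmx.
Proof.
have [->|m0 /(_ isT)] := eqVneq (mu T t) 0.
  by rewrite scale0r addr0 unitmx1.
rewrite -unitmx_char_poly => u.
have -> : 1%:M + mu T t *: A = - mu T t *: ((- (mu T t)^-1)%:M - A).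
  by rewrite scalerBr scale_scalar_mx mulrNN divff// scaleNr opprK.
by rewrite unitmxZ// unitfE oppr_eq0.
Qed.

(** Row [k] of the companion matrix sends the vector of powers to [z ^+ k.+1], except the last row,
    which holds the negated coefficients of [p]. Hence the resolvent maps the last basis vector to
    the powers of [z] divided by the value of [p]. *)
Lemma companionmx_powers (R : realType) (p : {poly R}) (z : R[i]%C) :
  p \is monic ->
  (z%:M - cmx (companionmx p)) *m (\col_k z ^+ k) =
  (cpoly p).[z] *: \col_k (k == (size p).-2 :> nat)%:R.
Proof.
move=> pm; apply/colP => k; rewrite mulmxBl mul_scalar_mx !mxE -exprS.
have [kE|kd] := eqVneq (k : nat) (size p).-2.
  rewrite mulr1; have sp : (size p).-1 = k.+1.
    by have := ltn_ord k; rewrite kE; case: (size p) => [|[]].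
  (* The leading term, with coefficient 1, is [z ^+ k.+1]; the other terms come from the last
     row. *)
  rewrite (@horner_coef_wide _ (size p).-1.+1) ?size_map_poly ?leqSpred//.
  rewrite big_ord_recr/= /cpoly coef_map/=.
  have := pm; rewrite monicE lead_coefE => /eqP ->.
  rewrite mul1r [RHS]addrC; congr (_ + _).
    by rewrite -sp.
  rewrite -sumrN; apply: eq_bigr => l _.
  by rewrite !mxE kE eqxx rmorphN mulNr opprK coef_map.
rewrite mulr0; apply/eqP; rewrite subr_eq0 eq_sym; apply/eqP.
have kl : (k.+1 < (size p).-1)%N.
  have := ltn_ord k; rewrite leq_eqVlt => /orP[/eqP e|//].
  by case/eqP: kd; exact: (congr1 predn e).
rewrite (bigD1 (Ordinal kl))//= big1 ?addr0 => [|l lk].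
  by rewrite !mxE (negbTE kd) eqxx mul1r.
rewrite !mxE (negbTE kd) (_ : _ == _ = false) ?mul0r//.
by apply: contraNF lk => /eqP e; apply/eqP/val_inj.
Qed.

(** Input [j] drives the last state, and output [i] combines the states with the coefficients of
    [num]. The characteristic polynomial of the companion matrix is [den], so the condition on its
    roots gives regressivity. *)
Lemma regressively_realizable_ratio (R : realType) (T : set R) (p q : nat)
    (i : 'I_p) (j : 'I_q) (num den : {poly R}) (g : R[i]%C -> R[i]%C) :
  (size num < size den)%N ->
  (forall t, T t -> mu T t != 0 -> den.[- (mu T t)^-1] != 0) ->
  (forall z, (cpoly den).[z] != 0 -> g z = (cpoly num).[z] / (cpoly den).[z]) ->
  regressively_realizable T (fun z => g z *: delta_mx i j : 'M_(p, q)).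
Proof.
wlog denm : num den / den \is monic => [W|] snd den0 gE.
  have d0 : lead_coef den != 0.
    by rewrite lead_coef_eq0; apply: contraTneq snd => ->; rewrite size_poly0.
  have dV : (lead_coef den)^-1 != 0 by rewrite invr_eq0.
  apply: (W ((lead_coef den)^-1 *: num) ((lead_coef den)^-1 *: den)).
  - by rewrite monicE lead_coefZ mulVf.
  - by rewrite !size_scale.
  - by move=> t Tt mt; rewrite hornerZ mulf_neq0// den0.
  - move=> z; rewrite /cpoly !linearZ/= !hornerZ mulf_eq0 negb_or => /andP[c0 dz].
    by rewrite gE// -mulf_div divff// mul1r.
pose d := (size den).-1.
pose c : 'rV[R]_d := \row_k num`_k.
pose b : 'cV[R]_d := \col_k (k == d.-1 :> nat)%:R.
exists d, (LinearSystem (companionmx den) (b *m delta_mx 0 j) (delta_mx i 0 *m c)).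
split=> [t Tt|z] /=.
  by apply: unitmx_regressive => mt; rewrite companionmxK// den0.
move=> u; have dz : (cpoly den).[z] != 0.
  by move: u; rewrite unitmx_char_poly -map_char_poly companionmxK.
rewrite gE// /cmx !map_mxM !map_delta_mx -!mulmxA.
(* In this form [b] cancels the inverse of [z%:M - A]. *)
have -> : map_mx (real_complex R) b = (cpoly den).[z]^-1 *:
    ((z%:M - cmx (companionmx den)) *m (\col_k z ^+ k)).
  rewrite companionmx_powers// scalerA mulVf// scale1r.
  by apply/colP => k; rewrite !mxE rmorph_nat.
rewrite -scalemxAl -scalemxAr -mulmxA mulKmx// -!scalemxAr mulmxA.
rewrite -mulmxA [map_mx _ c *m _]mulmxA [map_mx _ c *m _]mx11_scalar.
rewrite mul_scalar_mx -scalemxAr mul_delta_mx scalerA mulrC; congr (_ / _ *: _).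
(* As [size num <= d], the row [c] contains every coefficient of [num]. *)
rewrite mxE (@horner_coef_wide _ d).
  by apply: eq_bigr => k _; rewrite !mxE coef_map.
by rewrite size_map_poly -ltnS prednK// (leq_ltn_trans _ snd).
Qed.

(** * Continuity and cancellation of common factors *)

Lemma horner_continuous (K : numFieldType) (p : {poly K}) :
  continuous (horner p : K -> K).
Proof.
elim/poly_ind: p => [|p c ih] x.
  rewrite (_ : horner 0 = fun=> 0); first exact: cst_continuous.
  by apply/funext => z; rewrite horner0.
rewrite (_ : horner _ = fun z => p.[z] * z + c); last first.
  by apply/funext => z; rewrite hornerMXaddC.
exact: (cvgD (cvgM (ih x) cvg_id) (cvg_cst c)).
Qed.

(** Write [d] as [r * ('X - x%:P) ^+ m] with [r.[x] != 0]: the power vanishes at most at [x], and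
    [r] is nonzero near [x] by continuity. *)
Lemma near_dnbhs_horner_neq0 (K : numFieldType) (d : {poly K}) (x : K) :
  d != 0 -> \forall z \near x^', d.[z] != 0.
Proof.
move=> d0; have [m [r + ->]] := multiplicity_XsubC d x.
rewrite d0 /= rootE => rx.
near=> z; rewrite hornerM horner_exp hornerXsubC.
rewrite mulf_neq0 ?expf_neq0 ?subr_eq0//.
  near: z; apply: nbhs_dnbhs; exact: (cvgr_neq0 _ (@horner_continuous _ r x)).
by near: z; exact: nbhs_dnbhs_neq.
Unshelve. all: by end_near.
Qed.

(* An identity g * a = b of functions extends by continuity to the zeros of a
   nonzero polynomial, as these are isolated. *)
Lemma continuous_horner_extension (K : numFieldType) (g : K -> K)
    (d a b : {poly K}) (x : K) :
  {for x, continuous g} -> d != 0 ->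
  (forall z, d.[z] != 0 -> g z * a.[z] = b.[z]) -> g x * a.[x] = b.[x].
Proof.
move=> gx d0 gab; apply/eqP; rewrite -subr_eq0; apply/eqP.
pose h z := g z * a.[z] - b.[z].
have hx : {for x, continuous h}.
  exact: (cvgB (cvgM gx (@horner_continuous _ a x)) (@horner_continuous _ b x)).
(* Along the punctured neighbourhoods of [x], [h] tends to [h x] by continuity and to 0 because it
   vanishes where [d] does not. *)
apply: (@cvg_unique _ (@norm_hausdorff _ K) (h z @[z --> x^'])).
  exact/continuous_withinNx.
apply: cvg_near_cst; near=> z.
rewrite /h gab ?subrr//; near: z; exact: near_dnbhs_horner_neq0.
Unshelve. all: by end_near.
Qed.

Lemma strictly_proper_cancel (R : realType) (L : set R) (g : R[i]%C -> R[i]%C) :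
  (forall l, L l -> {for l%:C%C,
    continuous (g : (R[i]%C : numFieldType) -> (R[i]%C : numFieldType))}) ->
  strictly_proper_rational g ->
  exists num den : {poly R}, [/\ (size num < size den)%N,
    forall l, L l -> den.[l] != 0 &
    forall z, (cpoly den).[z] != 0 ->
      g z = (cpoly num).[z] / (cpoly den).[z]].
Proof.
move=> gL [num [den [+ +]]].
elim: {den}(size den) {-2}den (leqnn (size den)) num => [|n ih] den sn num.
  by move: sn; rewrite leqn0 => /eqP ->.
move=> snd gE.
have d0 : den != 0 by apply: contraTneq snd => ->; rewrite size_poly0.
have [[l Ll dl]|nl] := pselect (exists2 l, L l & den.[l] = 0); last first.
  by exists num, den; split=> // l Ll; apply/eqP => dl; apply: nl; exists l.
have cd0 : cpoly den != 0 by rewrite map_poly_eq0.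
have ext := continuous_horner_extension (gL _ Ll) cd0.
(* Extended to [l], the identity [g * den = num] has left side 0 there. *)
have nl : num.[l] = 0.
  have /ext : forall z, (cpoly den).[z] != 0 ->
      g z * (cpoly den).[z] = (cpoly num).[z].
    by move=> z z0; rewrite gE// divfK.
  rewrite /cpoly !horner_map dl mulr0 => /esym/eqP.
  by rewrite fmorph_eq0 => /eqP.
have /factor_theorem [den1 denE] : root den l by apply/rootP.
have /factor_theorem [num1 numE] : root num l by apply/rootP.
have d10 : den1 != 0 by apply: contraNneq d0 => e; rewrite denE e mul0r.
have sden : size den = (size den1).+1.
  by rewrite denE size_Mmonic ?monicXsubC// size_XsubC addn2.
have cM (f : {poly R}) z :
    (cpoly (f * ('X - l%:P))).[z] = (cpoly f).[z] * (z - l%:C%C).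
  by rewrite /cpoly rmorphM hornerM rmorphB/= map_polyX map_polyC hornerXsubC.
apply: (ih den1 _ num1).
- by rewrite -ltnS -sden.
(* The size formula for a product with a monic factor needs [num1 != 0]. *)
- have [->|n10] := eqVneq num1 0; first by rewrite size_poly0 size_poly_gt0.
  by move: snd; rewrite sden numE size_Mmonic ?monicXsubC// size_XsubC addn2.
move=> z z0.
have gE1 y : (cpoly den).[y] != 0 -> g y * (cpoly den1).[y] = (cpoly num1).[y].
  move=> y0; rewrite gE// denE numE !cM.
  move: y0; rewrite denE cM mulf_eq0 negb_or => /andP[y1 yl].
  by rewrite -mulf_div divff// mulr1 divfK.
apply: (mulIf z0); rewrite divfK//.
(* At [l] the original fraction says nothing about [g]; once [den1] no longer vanishes there, the
   value is forced by continuity. *)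
have [->|zl] := eqVneq z l%:C%C; first exact: ext.
by apply: gE1; rewrite denE cM mulf_neq0// subr_eq0.
Qed.

Theorem theorem4p5 (R : realType) (T : set R) (p q : nat)
    (G : R[i]%C -> 'M[R[i]%C]_(p, q))
    (hT : time_scale T)
    (hunbounded : ~ has_ubound T)
    (hgraininess : has_ubound [set mu T t | t in T])
    (hregressive : regressive_transfer T G) :
  (exists n (S : linear_system R n p q), regressive T S /\ realizes S G) <->
  (forall (i : 'I_p) (j : 'I_q), strictly_proper_rational (fun z => G z i j)).
Proof.
split=> [[n [S [_ SG]]] i j|spG]; first exact: strictly_proper_realizes SG.
suff : regressively_realizable T
    (fun z => \sum_i \sum_j G z i j *: delta_mx i j).
  by under eq_fun do rewrite -matrix_sum_delta.
apply: regressively_realizable_sum => i; apply: regressively_realizable_sum => j.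
(* These are the points that the eigenvalues of a regressive system avoid. *)
pose L := [set l : R | exists t, [/\ T t, mu T t != 0 & l = - (mu T t)^-1]].
have [|num [den [snd denL gE]]] := @strictly_proper_cancel _ L _ _ (spG i j).
  by move=> _ [t [Tt mt ->]]; exact: hregressive.
apply: regressively_realizable_ratio snd _ gE => t Tt mt.
by apply: denL; exists t.
Qed.
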